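(* The partially persistent array of Davoodi et al., modified so that its topmost space-time tree is stored in the CORoBTS data structure with arity between $2$ and $3$ (as described in the context), has space complexity $\mathcal{O}(U+V\log U)$, where $U$ is the size of the present array and $V$ is the number of versions.
   Context: A partially persistent array of size $U$ supports writes to the present version (each write to one cell creates a new version) and reads of any cell in any previous version. Writes are viewed as points in a 2D space-time plane (cell index horizontally, version vertically). The structure consists of: an ordinary array holding the present version; a log of all writes (used to rebuild with $U$ doubled when a cell beyond $U$ is written); and a sequence of space-time trees (ST-trees). Each ST-tree node represents a space-time rectangle; its children partition it. An ST-tree root represents a rectangle of width $U$ and height at most $U$; after every $U$ writes the top (newest) ST-tree is closed and a new one is created above it. A newly created ST-tree is a complete binary tree with $U$ leaves (one per cell), and a subtree of height $h$ represents a rectangle of width $2^{h-1}$. A leaf is full if it contains a write point; an internal node is full if it has two full children. On a write, the point is added to the appropriate open leaf and the lowest non-full ancestor is expanded: it gains a third child whose rectangle lies above a full child, namely a new complete binary subtree of the same height as that child, initialized with the values on its bottom boundary. Non-top ST-trees are stored compressed in van Emde Boas layout. In the modified version, the top ST-tree is stored in CORoBTS: its vertices are kept in van Emde Boas order (parameter $0<\varepsilon\le1/2$) in a packed-memory array (linear space in the number of vertices, constant-size gaps), without parent pointers; instead of pointers into the tree from outside, two fingers (stacks of pointers to all vertices on the branch to the last read leaf and to the last written leaf) are maintained. *)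

(* Defs.v *)
From mathcomp Require Import all_boot all_order all_algebra.

Set Implicit Arguments.
Unset Strict Implicit.
Unset Printing Implicit Defensive.

Import Order.TTheory GRing.Theory Num.Theory.

(* Versions are numbered 0, 1, 2, ...: version 0 is the initial array and the  *)
(* v-th write (v >= 1) creates version v; in the space-time plane it is the    *)
(* point (cell, v). An array cell, a cell index, a version number and a memory *)
(* address are each one machine word.                                          *)

(* Space-time rectangle: cells in [clo, chi), versions in (vlo, vhi]. Its      *)
(* bottom boundary is version vlo.                                             *)
Record rect := Rect { clo : nat; chi : nat; vlo : nat; vhi : nat }.

(* [Leaf x pt]: one cell, with value [x] on the bottom boundary and possibly   *)
(* one write point [pt] (version, value).                                      *)
(* [Tern l r s b t]: a vertex with children [l] (left half of the columns) and *)
(* [r] (right half) that was expanded by a third child [t] lying above [r] if  *)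
(* [s] and above [l] otherwise; [b] is the version separating [t] from it.     *)
Inductive sttree (A : Type) :=
  | Leaf of A & option (nat * A)
  | Bin of sttree A & sttree A
  | Tern of sttree A & sttree A & bool & nat & sttree A.
Arguments Leaf {A}.

Fixpoint full A (T : sttree A) : bool :=
  match T with
  | Leaf _ pt => isSome pt
  | Bin l r => full l && full r
  | Tern l r _ _ t => 2 <= full l + full r + full t
  end.

(* Below, a tree of level k is one of height k.+1, hence of width 2 ^ k.       *)
Fixpoint complete A (k lo : nat) (vals : nat -> A) : sttree A :=
  if k is k'.+1 then
    Bin (complete k' lo vals) (complete k' (lo + 2 ^ k') vals)
  else Leaf (vals lo) None.

Section Insert.
Variables (A : Type) (c v : nat) (a : A) (vals : nat -> A).

(* [Te] is a vertex of level k, starting at cell [lo], after the point was     *)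
(* added below its half [s]; the flag tells whether a lower ancestor of the    *)
(* point was expanded. The lowest non-full ancestor is always still binary:    *)
(* a third child lies above a full one, so once it is full, or the remaining   *)
(* child is, two children are.                                                 *)
Definition expand (k lo : nat) (s : bool) (Te : sttree A * bool) :=
  let: (T, done) := Te in
  if done || full T then (T, done) else
  if T is Bin l r then
    (Tern l r s v (complete k.-1 (if s then lo + 2 ^ k.-1 else lo) vals), true)
  else (T, done).

(* Write [a] to cell [c] as version [v]; [vals] is the array after this write. *)
Fixpoint insert (k lo : nat) (T : sttree A) : sttree A * bool :=
  let mid := lo + 2 ^ k.-1 in
  let s := mid <= c in
  match T with
  | Leaf x _ => (Leaf x (Some (v, a)), false)
  | Bin l r =>
      expand k lo s
        (if s then let: (r', e) := insert k.-1 mid r in (Bin l r', e)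
         else let: (l', e) := insert k.-1 lo l in (Bin l' r, e))
  | Tern l r s' b t =>
      expand k lo s
        (if s == s' then
           let: (t', e) := insert k.-1 (if s' then mid else lo) t in
           (Tern l r s' b t', e)
         else if s then
           let: (r', e) := insert k.-1 mid r in (Tern l r' s' b t, e)
         else
           let: (l', e) := insert k.-1 lo l in (Tern l' r s' b t, e))
  end.

End Insert.

(* Branch (sequence of child indices) leading to the leaf whose rectangle      *)
(* contains (c, v); for v larger than all recorded versions this is the open   *)
(* leaf of cell c.                                                             *)
Fixpoint branch A (c v k lo : nat) (T : sttree A) : seq nat :=
  let mid := lo + 2 ^ k.-1 in
  let s := mid <= c in
  let start := if s then mid else lo in
  match T with
  | Leaf _ _ => [::]
  | Bin l r =>
      nat_of_bool s :: (if s then branch c v k.-1 mid r else branch c v k.-1 lo l)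
  | Tern l r s' b t =>
      if (s == s') && (b < v) then 2 :: branch c v k.-1 start t
      else nat_of_bool s ::
             (if s then branch c v k.-1 mid r else branch c v k.-1 lo l)
  end.

(* Logical state. The capacity U of the array is [2 ^ lgU]; [wlog] lists the   *)
(* writes (cell, value) from the oldest one; [closed] lists the non-top        *)
(* ST-trees from the oldest one. A finger is the branch to the last read (or   *)
(* written) leaf of the top tree, [None] if there is no such leaf yet.         *)
Record state (A : Type) := State {
  lgU : nat;
  present : nat -> A;
  wlog : seq (nat * A);
  closed : seq (sttree A);
  top : sttree A;
  rfinger : option (seq nat);
  wfinger : option (seq nat) }.

(* [versions] is the number of writes, i.e. the initial version 0 is not       *)
(* counted; counting it would only weaken an upper bound on the space.         *)
Definition capacity A (s : state A) : nat := 2 ^ lgU s.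
Definition versions A (s : state A) : nat := size (wlog s).

Definition initial A (a0 : A) (k : nat) : state A :=
  State k (fun=> a0) [::] [::] (complete k 0 (fun=> a0)) None None.

(* A write to a cell c < U. Every U writes the top tree is closed.             *)
Definition push A (s : state A) (ca : nat * A) : state A :=
  let: (c, a) := ca in
  let k := lgU s in
  let v := (versions s).+1 in
  let arr := fun i => if i == c then a else present s i in
  let log := rcons (wlog s) (c, a) in
  let T := (insert c v a arr k 0 (top s)).1 in
  if 2 ^ k %| v then
    State k arr log (rcons (closed s) T) (complete k 0 arr) None None
  else
    State k arr log (closed s) T (rfinger s) (Some (branch c v k 0 (top s))).

(* A write to a cell c >= U first doubles U until c < U, rebuilding the whole  *)
(* structure from the log.                                                     *)
Definition write A (a0 : A) (s : state A) (c : nat) (a : A) : state A :=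
  if c < capacity s then push s (c, a)
  else push (foldl (@push A) (initial a0 (up_log 2 c.+1)) (wlog s)) (c, a).

(* Reading cell c in version t. The present version is read in the array, and  *)
(* version t in the ST-tree number (t - 1) / U, where it moves the read finger *)
(* if this tree is the top one. Out-of-range reads do nothing.                 *)
Definition read A (s : state A) (c t : nat) : state A :=
  if [&& c < capacity s, t < versions s & t.-1 %/ capacity s == size (closed s)]
  then State (lgU s) (present s) (wlog s) (closed s) (top s)
         (Some (branch c t (lgU s) 0 (top s))) (wfinger s)
  else s.

Inductive op (A : Type) := Write of nat & A | Read of nat & nat.
Arguments Read {A}.

Definition step A (a0 : A) (s : state A) (o : op A) : state A :=
  match o with Write c a => write a0 s c a | Read c t => read s c t end.

(* The state reached from an empty array of capacity 2 ^ k0.                   *)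
Definition run A (a0 : A) (k0 : nat) (ops : seq (op A)) : state A :=
  foldl (step a0) (initial a0 k0) ops.

(* A vertex of an ST-tree: branch from the root, rectangle, subtree.           *)
Record node (A : Type) :=
  Node { npath : seq nat; nrect : rect; ntree : sttree A }.

Definition kids A (n : node A) : seq (node A) :=
  let: Node p (Rect c0 c1 v0 v1) T := n in
  let mid := c0 + (c1 - c0)./2 in
  match T with
  | Leaf _ _ => [::]
  | Bin l r => [:: Node (rcons p 0) (Rect c0 mid v0 v1) l;
                   Node (rcons p 1) (Rect mid c1 v0 v1) r]
  | Tern l r s b t =>
      [:: Node (rcons p 0) (Rect c0 mid v0 (if s then v1 else b)) l;
          Node (rcons p 1) (Rect mid c1 v0 (if s then b else v1)) r;
          Node (rcons p 2)
            (Rect (if s then mid else c0) (if s then c1 else mid) b v1) t]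
  end.

Definition level A (d : nat) (n : node A) : seq (node A) :=
  iter d (fun ns => flatten [seq kids m | m <- ns]) [:: n].

(* Van Emde Boas order of the h topmost levels below [n], where [sp h] is the  *)
(* height of the bottom trees when a tree of height h is split; h is enough    *)
(* fuel.                                                                       *)
Fixpoint veb_rec A (sp : nat -> nat) (fuel h : nat) (n : node A) :
    seq (node A) :=
  if fuel is f.+1 then
    if h <= 1 then [:: n] else
      veb_rec sp f (h - sp h) n ++
      flatten [seq veb_rec sp f (sp h) m | m <- level (h - sp h) n]
  else [::].

(* The vertices of the i-th ST-tree, in van Emde Boas order.                   *)
Definition veb A (sp : nat -> nat) (k i : nat) (T : sttree A) : seq (node A) :=
  veb_rec sp k.+1 k.+1
    (Node [::] (Rect 0 (2 ^ k) (i * 2 ^ k) (i.+1 * 2 ^ k)) T).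

(* The splits allowed for the parameter eps: both parts have height at least   *)
(* floor (eps * h), whatever the rounding.                                     *)
Definition veb_split (R : realFieldType) (eps : R) (sp : nat -> nat) : Prop :=
  forall h, 1 < h ->
    [/\ 0 < sp h, sp h < h,
        (eps * h%:R < (sp h).+1%:R)%R & (eps * h%:R < (h - sp h).+1%:R)%R].

(* Vertex records: a rectangle, and either the two or three child addresses,   *)
(* or the content of a leaf. There are no parent pointers.                     *)
Inductive content (A : Type) :=
  | LeafRec of A & option (nat * A)
  | InnerRec of nat & nat & option nat.
Arguments InnerRec {A}.

Record vertex (A : Type) := Vertex { vrect : rect; vcontent : content A }.

Definition record_of A (addr : seq nat -> nat) (n : node A) : vertex A :=
  let: Node p rc T := n in
  Vertex rc
    match T with
    | Leaf x pt => LeafRec x pt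
    | Bin _ _ => InnerRec (addr (rcons p 0)) (addr (rcons p 1)) None
    | Tern _ _ _ _ _ =>
        InnerRec (addr (rcons p 0)) (addr (rcons p 1)) (Some (addr (rcons p 2)))
    end.

(* Position in a list of vertices of the one reached by branch p.              *)
Definition rank A (ns : seq (node A)) (p : seq nat) : nat :=
  index p [seq npath n | n <- ns].

(* Compressed storage: exactly one record per vertex, in vEB order.            *)
Definition compressed A (ns : seq (node A)) : seq (vertex A) :=
  [seq record_of (rank ns) n | n <- ns].

(* Packed-memory array: slots that are either empty or hold one record.        *)
Definition occupied (T : Type) (M : seq (option T)) : seq nat :=
  [seq i <- iota 0 (size M) | isSome (nth None M i)].

Definition pma_addr A (ns : seq (node A)) (M : seq (option (vertex A)))
    (p : seq nat) : nat :=
  nth 0 (occupied M) (rank ns p).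

(* No g.+1 consecutive slots are empty.                                        *)
Definition gaps_bounded (T : Type) (g : nat) (M : seq (option T)) : Prop :=
  forall i, i + g < size M ->
    exists2 j, i <= j <= i + g & isSome (nth None M j).

Definition pma_stores A (g : nat) (ns : seq (node A))
    (M : seq (option (vertex A))) : Prop :=
  gaps_bounded g M /\ pmap id M = [seq record_of (pma_addr ns M) n | n <- ns].

(* Stack of the addresses of all vertices on a branch, root first.             *)
Definition finger_stack (addr : seq nat -> nat) (f : option (seq nat)) :
    seq nat :=
  if f is Some p then [seq addr (take i p) | i <- iota 0 (size p).+1] else [::].

Record memory (A : Type) := Memory {
  m_present : seq A;
  m_log : seq (nat * A);
  m_closed : seq (seq (vertex A));
  m_top : seq (option (vertex A));
  m_rfinger : seq nat;
  m_wfinger : seq nat }.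

(* The memory [m] stores the state [s]: non-top trees are compressed in the    *)
(* usual vEB layout (split at half height), the top one is in a packed-memory  *)
(* array with gaps at most [g], in the vEB order given by [sp].                *)
Definition stores A (g : nat) (sp : nat -> nat) (s : state A) (m : memory A) :
    Prop :=
  let k := lgU s in
  let ns := veb sp k (size (closed s)) (top s) in
  [/\ m_present m = [seq present s i | i <- iota 0 (capacity s)],
      m_log m = wlog s,
      m_closed m = [seq compressed (veb uphalf k iT.1 iT.2)
                   | iT <- zip (iota 0 (size (closed s))) (closed s)],
      pma_stores g ns (m_top m) &
      m_rfinger m = finger_stack (pma_addr ns (m_top m)) (rfinger s) /\
      m_wfinger m = finger_stack (pma_addr ns (m_top m)) (wfinger s)].

(* Words of a vertex record: the rectangle takes 4, a leaf 5 more (constructor *)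
(* tag, initial value, presence flag, version and value of the point), and an  *)
(* inner vertex also 5 more (tag, two addresses, presence flag, address).      *)
Definition vertex_words : nat := 9.

(* An empty slot of the packed-memory array takes as much as an occupied one.  *)
Definition slot_words : nat := vertex_words.+1.

(* Total space in words; each closed tree also takes 2 words (address and      *)
(* size) in the directory of the sequence of trees.                            *)
Definition words A (m : memory A) : nat :=
  size (m_present m) + 2 * size (m_log m)
  + \sum_(t <- m_closed m) (2 + vertex_words * size t)
  + slot_words * size (m_top m)
  + size (m_rfinger m) + size (m_wfinger m).

(* Main.v *)
Require Import Defs.
From mathcomp Require Import all_boot all_order all_algebra.
From mathcomp Require Import zify.
(* [closed] would otherwise be the notation of fingraph. *)
Import Defs.

(** A full vertex of level [k] contains at least [2 ^ k] write points, and the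
    third child of a vertex of level [k] lies above a full child of level
    [k - 1]. The [2 ^ k - 1] vertices of the complete tree that an expansion
    creates are therefore paid for by the points of that full child. A point is
    charged at most once per level, so a tree of level [k] with [p] points has
    at most [2 * 2 ^ k + 2 * k * p] vertices. Every closed tree accounts for
    [2 ^ k = U] writes of its own, which absorbs the first summand. *)

Set Implicit Arguments.
Unset Strict Implicit.
Unset Printing Implicit Defensive.

(** * Shape and size of ST-trees *)

Section Trees.
Variable A : Type.
Implicit Types (T l r t : sttree A) (n : node A) (ns : seq (node A)).

Fixpoint points T : nat :=
  match T with
  | Leaf _ pt => isSome pt
  | Bin l r => points l + points r
  | Tern l r _ _ t => points l + points r + points t
  end.

Fixpoint vertices T : nat :=
  match T with
  | Leaf _ _ => 1
  | Bin l r => (vertices l + vertices r).+1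
  | Tern l r _ _ t => (vertices l + vertices r + vertices t).+1
  end.

(** Invariant of reachable trees: the type [sttree] enforces neither equal heights nor fullness of
    the child below a third one. *)
Fixpoint shaped (k : nat) T : bool :=
  match T with
  | Leaf _ _ => k == 0
  | Bin l r => [&& 0 < k, shaped k.-1 l & shaped k.-1 r]
  | Tern l r s _ t =>
      [&& 0 < k, shaped k.-1 l, shaped k.-1 r, shaped k.-1 t
        & full (if s then r else l)]
  end.

Lemma shaped_complete k lo (vals : nat -> A) : shaped k (complete k lo vals).
Proof. by elim: k lo => //= k IH lo; rewrite !IH. Qed.

Lemma points_complete k lo (vals : nat -> A) : points (complete k lo vals) = 0.
Proof. by elim: k lo => //= k IH lo; rewrite !IH. Qed.

(** Two full children double the bound at each level; at a ternary vertex these may be any two of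
    the three. *)
Lemma full_points k T : shaped k T -> full T -> 2 ^ k <= points T.
Proof.
elim: T k => [x pt|l IHl r IHr|l IHl r IHr s b t IHt] k /=.
- by move=> /eqP-> ->.
- case: k => //= k /andP[/IHl{}IHl /IHr{}IHr] /andP[/IHl{}IHl /IHr{}IHr].
  by rewrite expnS; lia.
case: k => //= k /and4P[/IHl{}IHl /IHr{}IHr /IHt{}IHt _].
rewrite expnS.
by case: (full l) (full r) (full t) IHl IHr IHt => [] [] [] //=; lia.
Qed.

(** The successor lets the bounds of two children simply add up. The leading term of a third child
    is absorbed by the growth of [2 * k * points T] with one more level. *)
Lemma vertices_le k T :
  shaped k T -> (vertices T).+1 <= 2 * 2 ^ k + 2 * k * points T.
Proof.
elim: T k => [x pt|l IHl r IHr|l IHl r IHr s b t IHt] k /=.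
- by move=> /eqP->.
- case: k => //= k /andP[/IHl{}IHl /IHr{}IHr].
  by rewrite expnS; nia.
case: k => //= k /and4P[shl shr /IHt{}IHt fullc].
have ptsc : 2 ^ k <= points l + points r.
  by case: s fullc => /full_points; [move/(_ _ shr)|move/(_ _ shl)]; lia.
move: (IHl _ shl) (IHr _ shr); rewrite expnS; nia.
Qed.

Lemma size_branch c v k lo T : shaped k T -> size (branch c v k lo T) <= k.
Proof.
elim: T k lo => [x pt|l IHl r IHr|l IHl r IHr s b t IHt] k lo //=.
- by case: k => //= k /andP[shl shr]; case: ifP => _; rewrite ltnS; auto.
case: k => //= k /and4P[shl shr sht _].
by case: ifP => _ /=; [|case: ifP => _]; rewrite ltnS; auto.
Qed.

(* The third conjunct is what places a new third child above a full child: as  *)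
(* long as nothing was expanded, all vertices passed so far are full.          *)
Lemma insertP c v (a : A) vals k lo T (Te := insert c v a vals k lo T) :
  shaped k T ->
  [/\ shaped k Te.1, full T -> full Te.1, ~~ Te.2 -> full Te.1
    & points Te.1 <= (points T).+1].
Proof.
rewrite {}/Te; elim: T k lo => [x pt|l IHl r IHr|l IHl r IHr s b t IHt] k lo /=.
- by move=> ->; split.
- case: k => //= k /andP[shl shr].
  have [sd|sd] := boolP (lo + 2 ^ k <= c).
    have := IHr _ (lo + 2 ^ k) shr.
    case: insert => r' e /= [shr' mono done_full pts].
    rewrite /expand; case: ifP => /= [|/norP[/done_full fr' nf]].
      move=> ef; rewrite shl shr'; split=> //.
      - by case/andP=> -> /mono.
      - by move: ef; case: e {done_full} => //=.
      - by lia.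
    (* The vertex is expanded: nothing was expanded below, so [r'] is full and may carry the third
       child. The vertex was not full before, since by [mono] this would contradict [nf]. *)
    rewrite shl shr' shaped_complete fr' points_complete; split=> //; last by lia.
    by case/andP=> fl /mono fr; case/negP: nf; rewrite fl.
  have := IHl _ lo shl.
  case: insert => l' e /= [shl' mono done_full pts].
  rewrite /expand; case: ifP => /= [|/norP[/done_full fl' nf]].
    move=> ef; rewrite shl' shr; split=> //.
    - by case/andP=> /mono -> ->.
    - by move: ef; case: e {done_full} => //=.
    - by lia.
  rewrite shl' shr shaped_complete fl' points_complete; split=> //; last by lia.
  by case/andP=> fl fr; case/negP: nf; rewrite fr fl'.
case: k => //= k /and4P[shl shr sht fc].
(* As [expand] leaves ternary vertices unchanged, their fullness comes from two children: the one
   under the third child, by [fc], and the one that received the point, by [done_full]. *)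
have expand_tern l' r' s0 s1 b' t' e :
    expand v vals k.+1 lo s0 (Tern l' r' s1 b' t', e)
    = (Tern l' r' s1 b' t', e).
  by rewrite /expand; case: ifP.
have [->|] := eqVneq.
  have := IHt _ (if s then lo + 2 ^ k else lo) sht.
  case: insert => t' e; rewrite expand_tern /= => -[sht' mono done_full pts].
  rewrite shl shr sht' fc; split=> //; last by lia.
    by case: (full t) mono => [->|] //; lia.
  by move/done_full=> ->; case: ifP fc => _ ->; lia.
case: ifP => _ ns.
  have := IHr _ (lo + 2 ^ k) shr.
  case: insert => r' e; rewrite expand_tern /= => -[shr' mono done_full pts].
  rewrite shl shr' sht; case: s ns fc => //= _ fl.
  rewrite fl; split=> //; last by lia.
    by case: (full r) mono => [->|] //; lia.
  by move/done_full=> ->.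
have := IHl _ lo shl.
case: insert => l' e; rewrite expand_tern /= => -[shl' mono done_full pts].
rewrite shl' shr sht; case: s ns fc => //= _ fr.
rewrite fr; split=> //; last by lia.
  by case: (full l) mono => [->|] //; lia.
by move/done_full=> ->.
Qed.

(** * Van Emde Boas layouts *)

Local Notation descend := (fun ns => flatten [seq kids m | m <- ns]).

Lemma iter_descend_cat e ns1 ns2 :
  iter e descend (ns1 ++ ns2) = iter e descend ns1 ++ iter e descend ns2.
Proof. by elim: e => //= e ->; rewrite map_cat flatten_cat. Qed.

Lemma iter_descend e ns :
  iter e descend ns = flatten [seq level e m | m <- ns].
Proof.
elim: ns => [|n ns IH]; first by elim: e => //= e ->.
by rewrite -cat1s iter_descend_cat IH.
Qed.

Lemma levelD d e n : level (d + e) n = flatten [seq level e m | m <- level d n].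
Proof. by rewrite /level addnC iterD iter_descend. Qed.

(** Level [d + 1] concatenates the levels [d] of the children, so exchanging the sums leaves one
    induction hypothesis per child. *)
Lemma size_levels_le h n :
  \sum_(0 <= d < h) size (level d n) <= vertices (ntree n).
Proof.
elim: h n => [|h IH] n; first by rewrite big_nil.
rewrite big_nat_recl // [size (level 0 n)]/= add1n.
under eq_bigr => d _.
  by rewrite -(add1n d) levelD size_flatten /shape -map_comp sumnE big_map; over.
rewrite exchange_big /=.
case: n => p [c0 c1 v0 v1] [x pt|l r|l r s b t] /=; rewrite !(big_cons, big_nil) //.
- by rewrite ltnS addn0; apply: leq_add; apply: IH.
by rewrite ltnS addn0 addnA; apply: leq_add; [apply: leq_add|]; apply: IH.
Qed.

(** A split separates the levels above [h - sp h] from those below, so no vertex is listed twice;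
    running out of fuel only drops vertices. *)
Lemma size_veb_rec sp fuel h n :
  (forall h, 1 < h -> 0 < sp h < h) ->
  0 < h -> size (veb_rec sp fuel h n) <= \sum_(0 <= d < h) size (level d n).
Proof.
move=> spP; elim: fuel h n => //= f IH h n h_gt0.
case: (leqP h 1) => [h_le1|h_gt1].
  have -> : h = 1 by lia.
  by rewrite big_nat1.
have /andP[sp_gt0 sp_lth] := spP h h_gt1.
rewrite size_cat size_flatten /shape -map_comp sumnE big_map.
rewrite (big_cat_nat (n := h - sp h)) //=; last exact: leq_subr.
apply: leq_add; first by apply: IH; lia.
rewrite -{2}[h - sp h]add0n big_addn subKn; last exact: ltnW.
under [leqRHS]eq_bigr => d _.
  by rewrite addnC levelD size_flatten /shape -map_comp sumnE big_map /=; over.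
by rewrite exchange_big /=; apply: leq_sum => m _; apply: IH.
Qed.

Lemma size_veb_le sp k i T :
  (forall h, 1 < h -> 0 < sp h < h) -> size (veb sp k i T) <= vertices T.
Proof.
move=> spP; apply: (leq_trans (size_veb_rec _ _ spP _)) => //.
exact: size_levels_le.
Qed.

End Trees.

Lemma uphalf_split h : 1 < h -> 0 < uphalf h < h.
Proof. by lia. Qed.

(** Cut the array into blocks of [g.+1] slots: each holds a record, and the incomplete last block
    costs at most [g]. *)
Lemma size_gaps_bounded (T : Type) g (M : seq (option T)) :
  gaps_bounded g M -> size M <= g.+1 * size (pmap id M) + g.
Proof.
have [n] := ubnP (size M); elim: n M => // n IH M.
rewrite ltnS => sM gM; have [|gM_lt] := leqP (size M) g; first by lia.
have gD : gaps_bounded g (drop g.+1 M).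
  move=> i; rewrite size_drop => ig.
  have [|j ji sj] := gM (g.+1 + i); first by lia.
  exists (j - g.+1); first by lia.
  by rewrite nth_drop subnKC //; lia.
have := IH _ _ gD; rewrite size_drop => /(_ ltac:(lia)).
have [j /= ji sj] := gM 0 gM_lt.
have : 0 < size (pmap id (take g.+1 M)).
  rewrite size_pmap -has_count; apply/(has_nthP None); exists j.
    by rewrite size_take; case: ifP; lia.
  by rewrite nth_take //; lia.
have -> : pmap id M = pmap id (take g.+1 M) ++ pmap id (drop g.+1 M).
  by rewrite -pmap_cat cat_take_drop.
by rewrite size_cat; nia.
Qed.

Lemma size_finger_stack addr f :
  size (finger_stack addr f) <= (size (odflt [::] f)).+1.
Proof. by case: f => //= p; rewrite size_map size_iota. Qed.

(** * Reachable states *)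

Section Runs.
Variable A : Type.
Implicit Types (s : state A) (T : sttree A).

(** Points are bounded over all trees together, so that the terms [k * points] of [vertices_le] add
    up to at most [k * versions s]. *)
Definition balanced s : Prop :=
  [/\ shaped (lgU s) (top s), all (shaped (lgU s)) (closed s),
      size (closed s) = versions s %/ capacity s,
      \sum_(T <- closed s) points T + points (top s) <= versions s &
      size (odflt [::] (rfinger s)) <= lgU s /\
      size (odflt [::] (wfinger s)) <= lgU s].

Lemma balanced_initial a0 k : balanced (initial a0 k : state A).
Proof.
split=> //=; first exact: shaped_complete; first by rewrite div0n.
by rewrite big_nil points_complete.
Qed.

Lemma balanced_push s ca : balanced s -> balanced (push s ca).
Proof.
case: ca => c a; rewrite /balanced /push /capacity /versions.
case=> shT shC szC pts [rf wf]; set arr := fun i => if _ then _ else _.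
have [] := @insertP A c (size (wlog s)).+1 a arr (lgU s) 0 (top s) shT.
set T := (insert _ _ _ _ _ _ _).1 => shT' _ _ ptsT.
(* The quotient grows exactly when the capacity divides the new version number, which is the test
   for closing the top tree. *)
have := divnS (size (wlog s)) (expn_gt0 2 (lgU s)).
case: ifP => dvd divS; rewrite /= !size_rcons divS szC.
  rewrite all_rcons shT' shC -cats1 big_cat big_seq1 points_complete.
  by split=> //; [exact: shaped_complete|rewrite /=; lia].
split=> //; last by split=> //; exact: size_branch.
by lia.
Qed.

Lemma balanced_foldl_push s log :
  balanced s -> balanced (foldl (@push A) s log).
Proof.
elim: log s => //= ca log IH s bs.
by apply: IH; exact: balanced_push.
Qed.

Lemma balanced_step a0 s o : balanced s -> balanced (step a0 s o).
Proof.
case: o => [c a|c t] bs /=.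
  rewrite /write; case: ifP => _; apply: balanced_push => //.
  (* A rebuild replays the log from an initial state, so the invariant is established afresh for the
     new capacity. *)
  exact/balanced_foldl_push/balanced_initial.
rewrite /read; case: ifP => // _; case: bs => shT shC szC pts [rf wf].
by split=> //=; split=> //; exact: size_branch.
Qed.

Lemma balanced_run a0 k0 ops : balanced (run a0 k0 ops : state A).
Proof.
rewrite /run; have := balanced_initial a0 k0; move: (initial a0 k0).
by elim: ops => //= o ops IH s bs; apply: IH; exact: balanced_step.
Qed.

(** Nine words per vertex turn the factors 2 of [vertices_le] into 18; the two directory words per
    tree account for 20. *)
Lemma words_closed_le k (Ts : seq (sttree A)) :
  all (shaped k) Ts ->
  \sum_(t <- [seq compressed (veb uphalf k iT.1 iT.2)
             | iT <- zip (iota 0 (size Ts)) Ts]) (2 + vertex_words * size t)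
  <= 20 * (size Ts * 2 ^ k) + 18 * (k * \sum_(T <- Ts) points T).
Proof.
move: (iota 0 (size Ts)) => js; rewrite big_map.
elim: Ts js => [|T Ts IH] [|j js] /=; rewrite ?big_nil // !big_cons /=.
move=> /andP[shT /(IH js)]; have := vertices_le shT.
have := size_veb_le k j T uphalf_split.
rewrite size_map /vertex_words; have := expn_gt0 2 k.
nia.
Qed.

End Runs.

Theorem mainTheorem2 (g : nat) :
  exists C : nat,
  forall (R : realFieldType) (eps : R) (sp : nat -> nat),
    (0 < eps <= 1 / 2%:R)%R -> veb_split eps sp ->
  forall (A : Type) (a0 : A) (k0 : nat) (ops : seq (op A)) (m : memory A),
    let s := run a0 k0 ops in
    stores g sp s m ->
    2 <= capacity s ->
    words m <= C * (capacity s + versions s * trunc_log 2 (capacity s)).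
Proof.
(* For the versions, 40 is 2 (log) + 20 + 18 (closed trees). For the capacity, 30 is ten words per
   slot times 2 from [vertices_le] plus 1 for the last gap. *)
exists (40 + 30 * g.+1) => R eps sp _ spP A a0 k0 ops m s.
have {}spP h : 1 < h -> 0 < sp h < h.
  by move/spP => -[-> ->].
case=> m_pres m_lg m_cl [gM recs] [m_rf m_wf] cap2.
have [shT shC szC pts [rf wf]] := balanced_run a0 k0 ops.
rewrite -/s in shT shC szC pts rf wf.
have topM := size_gaps_bounded gM.
rewrite recs size_map in topM.
have topV := vertices_le shT.
have topN := size_veb_le (lgU s) (size (closed s)) (top s) spP.
have closedW := words_closed_le shC; rewrite -m_cl in closedW.
have rfW := size_finger_stack
  (pma_addr (veb sp (lgU s) (size (closed s)) (top s)) (m_top m)) (rfinger s).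
have wfW := size_finger_stack
  (pma_addr (veb sp (lgU s) (size (closed s)) (top s)) (m_top m)) (wfinger s).
rewrite -m_rf in rfW; rewrite -m_wf in wfW.
have closedV : size (closed s) * 2 ^ lgU s <= versions s.
  by rewrite szC; exact: leq_trunc_div.
rewrite /words m_pres m_lg size_map size_iota -/(versions s) /slot_words.
rewrite /vertex_words in closedW *.
rewrite /capacity trunc_expnK //.
(* With capacity 1 the logarithm would vanish, and [versions s] could not be absorbed by the
   product. *)
have k_gt0 : 0 < lgU s by move: cap2; rewrite /capacity; case: (lgU s).
(* This absorbs the two finger stacks, of at most [(lgU s).+1] words each, into the capacity. *)
have kU : lgU s < 2 ^ lgU s by exact: ltn_expl.
have pV : lgU s * (\sum_(T <- closed s) points T) <= lgU s * versions s.
  by rewrite leq_mul2l (leq_trans (leq_addr _ _) pts) orbT.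
have qV : lgU s * points (top s) <= lgU s * versions s.
  by rewrite leq_mul2l (leq_trans (leq_addl _ _) pts) orbT.
have VkV : versions s <= lgU s * versions s by exact: leq_pmull.
have gN : g.+1 * size (veb sp (lgU s) (size (closed s)) (top s))
    <= g.+1 * (2 * 2 ^ lgU s + 2 * (lgU s * versions s)).
  by rewrite leq_mul2l; lia.
have gU : g.+1 <= g.+1 * 2 ^ lgU s by rewrite leq_pmulr // expn_gt0.
rewrite mulnDr !(mulnCA _ 2) in gN.
rewrite mulnDr !mulnDl -!mulnA [versions s * _]mulnC.
lia.
Qed.
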